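(* Let $n,a$ be integers with $n\ge 1$ and $1\le a\le n$. Then $$\begin{aligned}[F_{n+1}]_{q} ={}& q^{F_{a+1}F_{n-a+1}}[F_{n-a}]_{q^{F_{a}}}\,[F_{a}]_{q}\\ &+[F_{a}]_{q}\sum_{i=1}^{\lfloor n/a\rfloor-1}\left\{ q^{F_{a+1}F_{n-(i+1)a+1}}\left(\prod_{j=1}^{i}[F_{a+1}]_{q^{F_{n-ja+1}}}\right)[F_{n-(i+1)a}]_{q^{F_{a}}}\right\}\\ &+\left(\prod_{j=1}^{\lfloor n/a\rfloor}[F_{a+1}]_{q^{F_{n-ja+1}}}\right)\left[F_{n-\lfloor n/a\rfloor a+1}\right]_{q}.\end{aligned}$$
   Context: Fibonacci numbers: $F_0=0$, $F_1=1$, $F_n=F_{n-1}+F_{n-2}$. For an integer $m\ge 0$, $[m]_q=\sum_{i=0}^{m-1}q^i$ (so $[0]_q=0$), with $q$ an indeterminate, and $[m]_{q^s}=\sum_{i=0}^{m-1}q^{si}$ for an integer $s\ge 0$. Empty sums are $0$ and empty products are $1$. *)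

(* Defs.v *)
From mathcomp Require Import all_boot all_order all_algebra.
Set Implicit Arguments.
Unset Strict Implicit.
Unset Printing Implicit Defensive.
Import GRing.Theory.
Local Open Scope ring_scope.

Fixpoint fib (n : nat) : nat :=
  match n with
  | 0 => 0
  | 1 => 1
  | (m.+1 as p).+1 => fib p + fib m
  end%N.

(* [m]_{q^s}, the indeterminate q being 'X; the plain q-integer [m]_q is the
   case s = 1. *)
Definition qint (s m : nat) : {poly int} := \sum_(0 <= i < m) 'X^(s * i).

(* Main.v *)
(* Write n = m + a. Then F_(n+1) = F_(a+1) F_(m+1) + F_a F_m, and splitting the
   q-integer of this sum gives
     [F_(n+1)]_q = [F_(m+1)]_q [F_(a+1)]_(q^F_(m+1))
                   + q^(F_(a+1) F_(m+1)) [F_a]_q [F_m]_(q^F_a).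
   The theorem is this recurrence unrolled floor(n/a) times, the isolated first
   summand being the i = 0 term of the sum. *)
Require Import Defs.
From mathcomp Require Import all_boot all_order all_algebra.
Local Open Scope ring_scope.
Import GRing.Theory.

Lemma fib_add (m n : nat) :
  fib (m + n).+1 = (fib m.+1 * fib n.+1 + fib m * fib n)%N.
Proof.
elim: m n => [|m IHm] n; first by rewrite add0n mul1n mul0n addn0.
rewrite addSnnS IHm.
have -> : fib n.+2 = (fib n.+1 + fib n)%N by [].
have -> : fib m.+2 = (fib m.+1 + fib m)%N by [].
by rewrite mulnDr mulnDl addnAC.
Qed.

Lemma qint_add (s m n : nat) :
  qint s (m + n) = qint s m + 'X^(s * m) * qint s n.
Proof.
rewrite /qint (big_cat_nat (n := m)) ?leq_addr //=; congr (_ + _).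
rewrite -{1}[m]add0n big_addn addKn big_distrr /=.
by apply: eq_bigr => i _; rewrite -exprD -mulnDr addnC.
Qed.

Lemma qint0 (s : nat) : qint s 0 = 0.
Proof. by rewrite /qint big_geq. Qed.

(** The exponents split into [n] consecutive blocks of length [m]; block number [k] is the first one
    shifted by ['X^(s * m * k)]. *)
Lemma qint_mul (s m n : nat) : qint s (m * n) = qint s m * qint (s * m) n.
Proof.
elim: n => [|n IHn]; first by rewrite muln0 !qint0 mulr0.
rewrite mulnSr qint_add IHn -addn1 qint_add mulrDr /qint big_nat1 muln0 expr0.
by rewrite mulr1 mulnA [X in _ + X]mulrC.
Qed.

Lemma qint_fib_rec (n a : nat) : (a <= n)%N ->
  qint 1 (fib (n + 1)) =
    qint (fib (n - a + 1)) (fib (a + 1)) * qint 1 (fib (n - a + 1))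
    + qint 1 (fib a)
      * ('X^(fib (a + 1) * fib (n - a + 1)) * qint (fib a) (fib (n - a))).
Proof.
move=> le_an; rewrite -{1}(subnKC le_an) !addn1 fib_add qint_add.
(* The order of the factors decides which one keeps base ['X]: the swap makes it [fib (n - a).+1] in
   the first product, while [fib a] keeps it in the second. *)
rewrite [in qint 1 (fib a.+1 * _)]mulnC !qint_mul !mul1n.
by rewrite [_ * qint 1 _]mulrC mulrCA.
Qed.

(** Leaving the number [k] of unrollings free allows induction on it; the bound keeps the truncated
    subtractions exact. *)
Lemma qint_fib_iter (n a k : nat) : (k * a <= n)%N ->
  qint 1 (fib (n + 1)) =
    qint 1 (fib a) *
      \sum_(0 <= i < k)
        ('X^(fib (a + 1) * fib (n - (i + 1) * a + 1))
         * (\prod_(1 <= j < i.+1) qint (fib (n - j * a + 1)) (fib (a + 1)))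
         * qint (fib a) (fib (n - (i + 1) * a)))
    + (\prod_(1 <= j < k.+1) qint (fib (n - j * a + 1)) (fib (a + 1)))
      * qint 1 (fib (n - k * a + 1)).
Proof.
elim: k => [|k IHk] le_kn.
  by rewrite !big_geq // mulr0 add0r mul1r subn0.
have le_k : (k * a <= n)%N by apply: leq_trans le_kn; rewrite leq_mul.
have le_a : (a <= n - k * a)%N by rewrite leq_subRL // -mulSnr.
rewrite (IHk le_k).
(* The recurrence expands the trailing factor: one part lengthens the product, the other is the
   summand [i = k]. *)
rewrite (qint_fib_rec _ _ le_a) -subnDA -mulSnr (big_nat_recr k 0) // (big_nat_recr k.+1 1) //=.
rewrite [(k + 1)%N]addn1 !mulrDr -!addrA; congr (_ + _).
by rewrite addrC mulrA; congr (_ + _); rewrite mulrCA; congr (_ * _); rewrite mulrCA mulrA.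
Qed.

Theorem proposition2p10 (n a : nat) (hn : (1 <= n)%N) (ha1 : (1 <= a)%N)
    (han : (a <= n)%N) :
  qint 1 (fib (n + 1)) =
    'X^(fib (a + 1) * fib (n - a + 1)) * qint (fib a) (fib (n - a))
      * qint 1 (fib a)
    + qint 1 (fib a) *
      \sum_(1 <= i < n %/ a)
        ('X^(fib (a + 1) * fib (n - (i + 1) * a + 1))
         * (\prod_(1 <= j < i.+1) qint (fib (n - j * a + 1)) (fib (a + 1)))
         * qint (fib a) (fib (n - (i + 1) * a)))
    + (\prod_(1 <= j < (n %/ a).+1) qint (fib (n - j * a + 1)) (fib (a + 1)))
      * qint 1 (fib (n - n %/ a * a + 1)).
Proof.
(* Since [a <= n], the quotient is positive, so a term [i = 0] exists to be split off; its product
   is empty. *)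
rewrite (qint_fib_iter _ _ _ (leq_divM n a)) (big_ltn (m := 0)) ?divn_gt0 // mulrDr.
by rewrite add0n mul1n (big_geq (m := 1) (n := 1)) // mulr1 [X in X + _ + _ = _]mulrC.
Qed.
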